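(* Let $\mathcal{C}$ be a (spherical) fusion category and $\mathcal{D}\subset\mathcal{C}$ an integral fusion subcategory with $\mathrm{rank}(\mathcal{D})+2=\mathrm{rank}(\mathcal{C})$. Denote the elements of $\mathcal{O}(\mathcal{C})\setminus\mathcal{O}(\mathcal{D})$ by $\rho_1,\rho_2$. If there exists $X\in\mathcal{O}(\mathcal{D})$ such that $N_{X,\rho_1}^{\rho_2}$ or $N_{X,\rho_2}^{\rho_1}$ is nonzero, then $\dim(\rho_1)$ and $\dim(\rho_2)$ are quadratic integers (possibly rational).
   Context: Fusion categories are over $\mathbb{C}$; $\mathcal{O}(\mathcal{C})$ is the set of isomorphism classes of simple objects and $\mathrm{rank}(\mathcal{C})=|\mathcal{O}(\mathcal{C})|$. $N_{X,Y}^Z=\dim_{\mathbb{C}}\mathrm{Hom}_{\mathcal{C}}(Z,X\otimes Y)$ for simple $X,Y,Z$. $\mathcal{D}$ is integral if all its objects have integer Frobenius-Perron dimension. $\dim$ is the categorical dimension with respect to a spherical structure on $\mathcal{C}$. ''Quadratic integer (possibly rational)'' means an algebraic integer of degree at most $2$ over $\mathbb{Q}$. *)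

(* Defs.v *)
From HB Require Import structures.
From mathcomp Require Import all_boot all_order all_algebra.
From mathcomp Require Import reals complex.

Set Implicit Arguments.
Unset Strict Implicit.
Unset Printing Implicit Defensive.

Import Order.TTheory GRing.Theory Num.Theory.
Local Open Scope ring_scope.

Reserved Notation "g \oc f" (at level 50, left associativity).
Reserved Notation "X \ox Y" (at level 40, left associativity).
Reserved Notation "f \om g" (at level 40, left associativity).

(* Finite dimensionality of the Hom spaces is part of [vectType].
   Composition is written in the order of functions, g after f. *)
Record linearCategory (K : fieldType) := LinearCategory {
  obj :> Type;
  mor : obj -> obj -> vectType K;
  idm : forall X, mor X X;
  mcomp : forall X Y Z, mor Y Z -> mor X Y -> mor X Z;
  comp_linearl : forall X Y Z (f : mor X Y), linear (fun g => @mcomp X Y Z g f);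
  comp_linearr : forall X Y Z (g : mor Y Z), linear (@mcomp X Y Z g);
  compA : forall X Y Z W (h : mor Z W) (g : mor Y Z) (f : mor X Y),
    mcomp h (mcomp g f) = mcomp (mcomp h g) f;
  comp1m : forall X Y (f : mor X Y), mcomp (idm Y) f = f;
  compm1 : forall X Y (f : mor X Y), mcomp f (idm X) = f
}.

Arguments mor {K l} X Y.
Arguments idm {K l} X.
Arguments mcomp {K l X Y Z} g f.
Notation "g \oc f" := (mcomp g f) : ring_scope.

Section LinearCategoryTheory.
Variables (K : fieldType) (C : linearCategory K).
Implicit Types X Y Z : C.

Definition inverse_pair X Y (f : mor X Y) (g : mor Y X) : Prop :=
  g \oc f = idm X /\ f \oc g = idm Y.

Definition is_iso X Y (f : mor X Y) : Prop := exists g, inverse_pair f g.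

Definition isomorphic X Y : Prop := exists f : mor X Y, is_iso f.

Definition is_mono X Y (f : mor X Y) : Prop :=
  forall W (g h : mor W X), f \oc g = f \oc h -> g = h.

Definition is_epi X Y (f : mor X Y) : Prop :=
  forall W (g h : mor Y W), g \oc f = h \oc f -> g = h.

Definition is_kernel X Y Z (f : mor X Y) (k : mor Z X) : Prop :=
  f \oc k = 0 /\
  forall W (h : mor W X), f \oc h = 0 -> exists! u : mor W Z, k \oc u = h.

Definition is_cokernel X Y Z (f : mor X Y) (q : mor Y Z) : Prop :=
  q \oc f = 0 /\
  forall W (h : mor Y W), h \oc f = 0 -> exists! u : mor Z W, u \oc q = h.

(* initial and terminal; the unique map in a Hom space can only be 0 *)
Definition is_zero_obj X : Prop :=
  forall Y, (forall f : mor X Y, f = 0) /\ (forall f : mor Y X, f = 0).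

Definition is_direct_sum n (S : 'I_n -> C) X : Prop :=
  exists (inj : forall k, mor (S k) X) (proj : forall k, mor X (S k)),
    [/\ forall k, proj k \oc inj k = idm (S k),
        forall k l, k != l -> proj k \oc inj l = 0
      & \sum_(k < n) (inj k \oc proj k) = idm X].

(* For n = 0 the first condition provides a zero object. *)
Definition is_abelian : Prop :=
  [/\ forall n (S : 'I_n -> C), exists X, is_direct_sum S X,
      forall X Y (f : mor X Y), exists Z (k : mor Z X), is_kernel f k,
      forall X Y (f : mor X Y), exists Z (q : mor Y Z), is_cokernel f q,
      forall X Y (f : mor X Y), is_mono f ->
        exists Z (g : mor Y Z), is_kernel g f
    & forall X Y (f : mor X Y), is_epi f ->
        exists Z (g : mor Z X), is_cokernel g f].

Definition is_simple X : Prop :=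
  ~ is_zero_obj X /\
  forall Y (f : mor Y X), is_mono f -> is_zero_obj Y \/ is_iso f.

Definition is_semisimple : Prop :=
  forall X, exists n (S : 'I_n -> C),
    (forall k, is_simple (S k)) /\ is_direct_sum S X.

(* S lists each isomorphism class of simple objects satisfying P exactly once *)
Definition simple_transversal (P : C -> Prop) n (S : 'I_n -> C) : Prop :=
  [/\ forall k, is_simple (S k) /\ P (S k),
      forall k l, isomorphic (S k) (S l) -> k = l
    & forall X, is_simple X -> P X -> exists k, isomorphic X (S k)].

Definition has_rank (P : C -> Prop) (n : nat) : Prop :=
  exists S : 'I_n -> C, simple_transversal P S.

End LinearCategoryTheory.

Record monoidalCategory (K : fieldType) := MonoidalCategory {
  mcat :> linearCategory K;
  tens : mcat -> mcat -> mcat;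
  tensm : forall X X' Y Y' : mcat,
    mor X X' -> mor Y Y' -> mor (tens X Y) (tens X' Y');
  tensm_linearl : forall (X X' Y Y' : mcat) (g : mor Y Y'),
    linear (fun f => @tensm X X' Y Y' f g);
  tensm_linearr : forall (X X' Y Y' : mcat) (f : mor X X'),
    linear (@tensm X X' Y Y' f);
  tensm1 : forall X Y : mcat, tensm (idm X) (idm Y) = idm (tens X Y);
  tensm_comp : forall (X X' X'' Y Y' Y'' : mcat)
      (f' : mor X' X'') (f : mor X X') (g' : mor Y' Y'') (g : mor Y Y'),
    tensm (f' \oc f) (g' \oc g) = tensm f' g' \oc tensm f g;
  tunit : mcat;
  assoc : forall X Y Z : mcat, mor (tens (tens X Y) Z) (tens X (tens Y Z));
  assocV : forall X Y Z : mcat, mor (tens X (tens Y Z)) (tens (tens X Y) Z);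
  lunit : forall X : mcat, mor (tens tunit X) X;
  lunitV : forall X : mcat, mor X (tens tunit X);
  runit : forall X : mcat, mor (tens X tunit) X;
  runitV : forall X : mcat, mor X (tens X tunit);
  assoc_iso : forall X Y Z : mcat, inverse_pair (assoc X Y Z) (assocV X Y Z);
  lunit_iso : forall X : mcat, inverse_pair (lunit X) (lunitV X);
  runit_iso : forall X : mcat, inverse_pair (runit X) (runitV X);
  assoc_natural : forall (X X' Y Y' Z Z' : mcat)
      (f : mor X X') (g : mor Y Y') (h : mor Z Z'),
    assoc X' Y' Z' \oc tensm (tensm f g) h
    = tensm f (tensm g h) \oc assoc X Y Z;
  lunit_natural : forall (X Y : mcat) (f : mor X Y),
    lunit Y \oc tensm (idm tunit) f = f \oc lunit X;
  runit_natural : forall (X Y : mcat) (f : mor X Y),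
    runit Y \oc tensm f (idm tunit) = f \oc runit X;
  pentagon : forall W X Y Z : mcat,
    assoc W X (tens Y Z) \oc assoc (tens W X) Y Z
    = tensm (idm W) (assoc X Y Z) \oc assoc W (tens X Y) Z
        \oc tensm (assoc W X Y) (idm Z);
  triangle : forall X Y : mcat,
    tensm (idm X) (lunit Y) \oc assoc X tunit Y = tensm (runit X) (idm Y)
}.

Arguments tens {K m} X Y.
Arguments tensm {K m X X' Y Y'} f g.
Arguments tunit {K m}.
Arguments assoc {K m} X Y Z.
Arguments assocV {K m} X Y Z.
Arguments lunit {K m} X.
Arguments lunitV {K m} X.
Arguments runit {K m} X.
Arguments runitV {K m} X.
Notation "X \ox Y" := (tens X Y) : ring_scope.
Notation "f \om g" := (tensm f g) : ring_scope.

(* The object V, with e and c as evaluation and coevaluation, is a left dual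
   of X (equivalently, X is a right dual of V). *)
Definition is_left_dual (K : fieldType) (C : monoidalCategory K) (X V : C)
    (e : mor (V \ox X) tunit) (c : mor tunit (X \ox V)) : Prop :=
  runit X \oc (idm X \om e) \oc assoc X V X \oc (c \om idm X) \oc lunitV X
    = idm X /\
  lunit V \oc (e \om idm V) \oc assocV V X V \oc (idm V \om c) \oc runitV V
    = idm V.

Record fusionCategory (K : fieldType) := FusionCategory {
  fcat :> monoidalCategory K;
  dual : fcat -> fcat;
  ev : forall X : fcat, mor (dual X \ox X) tunit;
  coev : forall X : fcat, mor tunit (X \ox dual X);
  dual_left : forall X : fcat, is_left_dual (ev X) (coev X);
  dual_right : forall X : fcat,
    exists (V : fcat) (e : mor (X \ox V) tunit) (c : mor tunit (V \ox X)),
      is_left_dual e c;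
  fusion_abelian : is_abelian fcat;
  fusion_semisimple : is_semisimple fcat;
  fusion_finite : exists n, has_rank (fun _ : fcat => True) n;
  fusion_unit_simple : is_simple (@tunit K fcat)
}.

Arguments dual {K f} X.
Arguments ev {K f} X.
Arguments coev {K f} X.

Section FusionCategoryTheory.
Variables (K : fieldType) (C : fusionCategory K).
Implicit Types X Y Z V : C.

Definition fusion_coef X Y Z : nat := \dim {: mor Z (X \ox Y)}.

Definition curry V X (p : mor (V \ox X) tunit) : mor V (dual X) :=
  lunit (dual X) \oc (p \om idm (dual X)) \oc assocV V X (dual X)
    \oc (idm V \om coev X) \oc runitV V.

Definition dualm X Y (f : mor X Y) : mor (dual Y) (dual X) :=
  curry (ev Y \oc (idm (dual Y) \om f)).

(* the canonical isomorphism from Y^* (x) X^* to (X (x) Y)^* *)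
Definition dual_tens X Y : mor (dual Y \ox dual X) (dual (X \ox Y)) :=
  curry (ev Y \oc (idm (dual Y) \om
                    (lunit Y \oc (ev X \om idm Y) \oc assocV (dual X) X Y))
           \oc assoc (dual Y) (dual X) (X \ox Y)).

(* The monoidal structure of the double dual functor is the composite of
   dual_tens (Y^* ) (X^* ) : X^** (x) Y^** -> (Y^* (x) X^* )^* with the inverse
   of dualm (dual_tens X Y) : (X (x) Y)^** -> (Y^* (x) X^* )^*; pivotal_tens
   is the compatibility of piv with it, with the inverse moved across.
   Compatibility with the unit then follows from piv being invertible. *)
Record pivotalStructure := PivotalStructure {
  piv : forall X, mor X (dual (dual X));
  pivotal_iso : forall X, is_iso (piv X);
  pivotal_natural : forall X Y (f : mor X Y),
    dualm (dualm f) \oc piv X = piv Y \oc f;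
  pivotal_tens : forall X Y,
    dualm (dual_tens X Y) \oc piv (X \ox Y)
    = dual_tens (dual Y) (dual X) \oc (piv X \om piv Y)
}.

Definition pivotal_trace (a : pivotalStructure) X : mor (@tunit K C) tunit :=
  ev (dual X) \oc (piv a X \om idm (dual X)) \oc coev X.

(* The endomorphism pivotal_trace a X of the unit, read as a scalar by means
   of the basis (idm tunit) of End(tunit). *)
Definition cat_dim (a : pivotalStructure) X : K :=
  coord [tuple idm (@tunit K C)] ord0 (pivotal_trace a X).

Record sphericalStructure := SphericalStructure {
  pivotal_of_spherical :> pivotalStructure;
  spherical_dim : forall X,
    cat_dim pivotal_of_spherical X = cat_dim pivotal_of_spherical (dual X)
}.

(* D is the class of objects of a full subcategory; closure under direct
   summands includes closure under isomorphism, and makes the simple objects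
   of the subcategory the simple objects of C that lie in D. *)
Record is_fusion_subcategory (D : C -> Prop) : Prop := IsFusionSubcategory {
  fsub_unit : D tunit;
  fsub_tens : forall X Y, D X -> D Y -> D (X \ox Y);
  fsub_dual : forall X, D X -> D (dual X);
  fsub_direct_sum : forall n (S : 'I_n -> C) X,
    (forall k, D (S k)) -> is_direct_sum S X -> D X;
  fsub_summand : forall X Y (i : mor X Y) (p : mor Y X),
    p \oc i = idm X -> D Y -> D X
}.

(* r is the Frobenius-Perron dimension of X in the fusion subcategory D: the
   largest nonnegative eigenvalue of the matrix of left multiplication by X on
   the Grothendieck ring of D. *)
Definition is_FPdim (R : realType) (D : C -> Prop) X (r : R) : Prop :=
  exists n (S : 'I_n -> C),
    let M : 'M[R]_n := \matrix_(i, j) (fusion_coef X (S i) (S j))%:R in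
    [/\ simple_transversal D S, 0 <= r, eigenvalue M r
      & forall s : R, 0 <= s -> eigenvalue M s -> s <= r].

Definition is_integral (R : realType) (D : C -> Prop) : Prop :=
  forall X, D X -> exists m : int, is_FPdim D X (m%:~R : R).

End FusionCategoryTheory.

Definition quadratic_integer (K : numFieldType) (x : K) : Prop :=
  integralOver (intr : int -> K) x /\
  exists p : {poly rat},
    [/\ p != 0, (size p <= 3)%N & root (map_poly ratr p) x].

(* Main.v *)
(* The simple objects of D act on the span of rho1 and rho2: no constituent of
   X (x) rho_i lies in D, since otherwise rho_i would be a summand of an object
   of D. So (dim rho1, dim rho2) is an eigenvector of a 2x2 matrix of natural
   numbers with eigenvalue dim X (if it is zero there is nothing to prove).
   The Frobenius-Perron dimension of X is the Perron eigenvalue of that same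
   matrix and is an integer by hypothesis; hence dim X, a root of the same monic
   quadratic polynomial, is an integer as well. A nonzero off-diagonal entry
   for some X makes dim rho1 and dim rho2 rationally proportional, and
   decomposing rho_i (x) rho_i gives a quadratic equation with rational
   coefficients.
   Integrality comes from the characteristic polynomial of multiplication by
   rho_i on the Grothendieck ring.

   Additivity and multiplicativity of dim are proved with duality in the
   form of adjunctions between the functors X (x) -, for which reassociation
   is needed only when relating (X (x) Y) (x) - to X (x) (Y (x) -). *)
From HB Require Import structures.
From mathcomp Require Import all_boot all_order all_algebra.
From mathcomp Require Import ring lra.
From mathcomp Require Import boolp reals complex.
Require Import Defs.

Set Implicit Arguments.
Unset Strict Implicit.
Unset Printing Implicit Defensive.

Import Order.TTheory GRing.Theory Num.Theory.
Local Open Scope ring_scope.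

Reserved Notation "X \lw f" (at level 40, left associativity).
Reserved Notation "f \rw X" (at level 40, left associativity).

(** * Semisimple linear categories: Schur's lemma, split summands, Hom dimensions *)

Section LinearCategory.
Variables (K : fieldType) (C : linearCategory K).
Implicit Types X Y Z W : C.

HB.instance Definition _ X Y Z (g : mor Y Z) :=
  GRing.isLinear.Build K (mor X Y) (mor X Z) _ (@mcomp K C X Y Z g)
    (comp_linearr g).

Definition precomp X Y Z (f : mor X Y) (g : mor Y Z) : mor X Z := g \oc f.

HB.instance Definition _ X Y Z (f : mor X Y) :=
  GRing.isLinear.Build K (mor Y Z) (mor X Z) _ (@precomp X Y Z f)
    (comp_linearl f).

Lemma comp0m X Y Z (f : mor X Y) : (0 : mor Y Z) \oc f = 0.
Proof. exact: (linear0 (@precomp X Y Z f)). Qed.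

Lemma compm0 X Y Z (g : mor Y Z) : g \oc (0 : mor X Y) = 0.
Proof. exact: linear0. Qed.

Lemma comp_suml X Y Z (f : mor X Y) (I : Type) (r : seq I) (P : pred I)
    (g : I -> mor Y Z) :
  (\sum_(i <- r | P i) g i) \oc f = \sum_(i <- r | P i) (g i \oc f).
Proof. exact: (linear_sum (@precomp X Y Z f)). Qed.

Lemma comp_sumr X Y Z (g : mor Y Z) (I : Type) (r : seq I) (P : pred I)
    (f : I -> mor X Y) :
  g \oc (\sum_(i <- r | P i) f i) = \sum_(i <- r | P i) (g \oc f i).
Proof. exact: linear_sum. Qed.

Lemma compZl X Y Z k (g : mor Y Z) (f : mor X Y) : (k *: g) \oc f = k *: (g \oc f).
Proof. exact: (linearZ_LR (@precomp X Y Z f)). Qed.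

Lemma compZr X Y Z k (g : mor Y Z) (f : mor X Y) : g \oc (k *: f) = k *: (g \oc f).
Proof. exact: linearZ_LR. Qed.

(** Lets an equation between composites be used inside a right-nested chain, where its left side is
    not a subterm. *)
Lemma reassoc X Y Y' Z (g : mor Y Z) (f : mor X Y) (g' : mor Y' Z) (f' : mor X Y') :
  g \oc f = g' \oc f' ->
  forall W (h : mor W X), g \oc (f \oc h) = g' \oc (f' \oc h).
Proof. by move=> E W h; rewrite !compA E. Qed.

Lemma reassoc1 X Y Z (g : mor Y Z) (f : mor X Y) (k : mor X Z) :
  g \oc f = k -> forall W (h : mor W X), g \oc (f \oc h) = k \oc h.
Proof. by move=> E W h; rewrite compA E. Qed.

Lemma cancel_comp X Y (g : mor Y X) (f : mor X Y) :
  g \oc f = idm X -> forall W (h : mor W X), g \oc (f \oc h) = h.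
Proof. by move=> E W h; rewrite compA E comp1m. Qed.

Lemma isomorphic_refl X : isomorphic X X.
Proof. by exists (idm X), (idm X); split; rewrite comp1m. Qed.

Lemma isomorphic_sym X Y : isomorphic X Y -> isomorphic Y X.
Proof. by case=> f [g [gf fg]]; exists g, f; split. Qed.

Lemma isomorphic_trans X Y Z :
  isomorphic X Y -> isomorphic Y Z -> isomorphic X Z.
Proof.
case=> f [f' [f'f ff']] [g [g' [g'g gg']]].
exists (g \oc f), (f' \oc g'); split.
  by rewrite -compA (cancel_comp g'g).
by rewrite -compA (cancel_comp ff').
Qed.

Lemma direct_sum_isomorphic X Y :
  isomorphic X Y -> is_direct_sum (fun _ : 'I_1 => X) Y.
Proof.
case=> f [g [gf fg]]; exists (fun _ => f), (fun _ => g); split => //.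
  by move=> k l; rewrite !ord1 eqxx.
by rewrite big_ord1.
Qed.

Lemma zero_obj_idm X : idm X = 0 -> is_zero_obj X.
Proof.
move=> X0 Y; split=> f; first by rewrite -[f]compm1 X0 compm0.
by rewrite -[f]comp1m X0 comp0m.
Qed.

Lemma simple_idm_neq0 X : is_simple X -> idm X != 0.
Proof. by case=> nz _; apply/eqP => /zero_obj_idm. Qed.

Section Abelian.
Hypothesis abC : is_abelian C.

(** Schur's lemma. The kernel of [f] is a subobject of the simple [X]; if its inclusion were
    invertible, [f] would vanish, so the kernel is zero and [f] is a monomorphism into the simple
    [Y]. *)
Lemma simple_mor_iso X Y (f : mor X Y) :
  is_simple X -> is_simple Y -> f != 0 -> is_iso f.
Proof.
case: abC => _ kerC _ _ _ [nzX sX] [nzY sY] f0.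
have [Z [k [fk ku]]] := kerC _ _ f.
have mk : is_mono k.
  move=> W g h E.
  have fkg : f \oc (k \oc g) = 0 by rewrite compA fk comp0m.
  by have [u [_ uu]] := ku _ _ fkg; rewrite -(uu _ erefl) -(uu h).
have [zZ|[k' [_ kk']]] := sX _ _ mk; last first.
  by case/eqP: f0; rewrite -[f]compm1 -kk' compA fk comp0m.
have mf : is_mono f.
  move=> W g h E; apply/subr0_eq.
  have E0 : f \oc (g - h) = 0 by rewrite linearB /= E subrr.
  by have [u [<- _]] := ku _ _ E0; rewrite (proj2 (zZ _) u) compm0.
by case: (sY _ _ mf).
Qed.

Lemma dim_mor_simple_noniso X Y : is_simple X -> is_simple Y ->
  ~ isomorphic X Y -> \dim {: mor X Y} = 0%N.
Proof.
move=> sX sY nXY; apply/eqP; rewrite dimv_eq0; apply/eqP/vspaceP => f.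
rewrite memvf memv0; apply/esym/eqP; apply/eqP/negPn/negP => f0.
by apply: nXY; exists f; apply: simple_mor_iso.
Qed.

Section Semisimple.
Hypothesis ssC : is_semisimple C.

(** Some component of [f] into a simple summand of [W] is nonzero, hence invertible; its inverse
    after the projection retracts [f]. *)
Lemma simple_mono_split X W (f : mor X W) : is_simple X -> f != 0 ->
  exists r : mor W X, r \oc f = idm X.
Proof.
move=> sX f0; have [n [S [sS [i [p [pi _ ip]]]]]] := ssC W.
have [k pf0] : exists k, p k \oc f != 0.
  apply/existsP; apply: contraNT f0 => /existsPn pf0.
  rewrite -[f]comp1m -ip comp_suml big1 // => k _.
  by rewrite -compA (eqP (negPn (pf0 k))) compm0.
have [g [gf _]] := simple_mor_iso sX (sS k) pf0.
by exists (g \oc p k); rewrite -compA.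
Qed.

Lemma simple_epi_split X W (f : mor W X) : is_simple X -> f != 0 ->
  exists s : mor X W, f \oc s = idm X.
Proof.
move=> sX f0; have [n [S [sS [i [p [pi _ ip]]]]]] := ssC W.
have [k fi0] : exists k, f \oc i k != 0.
  apply/existsP; apply: contraNT f0 => /existsPn fi0.
  rewrite -[f]compm1 -ip comp_sumr big1 // => k _.
  by rewrite compA (eqP (negPn (fi0 k))) comp0m.
have [g [_ fg]] := simple_mor_iso (sS k) sX fi0.
by exists (i k \oc g); rewrite compA.
Qed.
End Semisimple.
End Abelian.

Lemma dim_mor_neq0 X Y : (\dim {: mor X Y} != 0)%N -> exists f : mor X Y, f != 0.
Proof.
rewrite dimv_eq0 => nz; exists (vpick {: mor X Y}).
by rewrite vpick0.
Qed.

Lemma dim_mor_gt0 X Y (f : mor X Y) : f != 0 -> (0 < \dim {: mor X Y})%N.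
Proof.
move=> f0; rewrite lt0n dimv_eq0; apply: contra f0 => /eqP E.
by rewrite -memv0 -E memvf.
Qed.

(** Postcomposition with the injections embeds the spaces [mor Z (S k)] in [mor Z W], which is the
    internal direct sum of their images. *)
Lemma dim_mor_direct_sum Z n (S : 'I_n -> C) W : is_direct_sum S W ->
  (\dim {: mor Z W} = \sum_(k < n) \dim {: mor Z (S k)})%N.
Proof.
case=> i [p [pi pi0 ip]].
pose g k := linfun (@mcomp K C Z (S k) W (i k)).
have gE k f : g k f = i k \oc f by rewrite lfunE.
have kerg k : lker (g k) == 0%VS.
  apply/lker0P => f h; rewrite !gE => E.
  by rewrite -[f](cancel_comp (pi k)) E (cancel_comp (pi k)).
have img u k : u \in limg (g k) -> u = i k \oc (p k \oc u).
  by case/memv_imgP => f _ ->; rewrite gE (cancel_comp (pi k)).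
have dir : directv (\sum_(k < n) limg (g k)).
  apply/directv_sum_independent => us usP us0 k _.
  (* The idempotent of the [k]-th summand fixes the [k]-th term of the relation and kills all
     others. *)
  have := congr1 (fun u => i k \oc (p k \oc u)) us0.
  rewrite !compm0 !comp_sumr (bigD1 k) //= -img ?usP // big1 ?addr0 //.
  move=> l lk; rewrite (img _ _ (usP l isT)) [p k \oc _]compA pi0 1?eq_sym //.
  by rewrite comp0m compm0.
have -> : {: mor Z W}%VS = (\sum_(k < n) limg (g k))%VS.
  apply/vspaceP => u; rewrite memvf; apply/esym.
  rewrite -[u]comp1m -ip comp_suml; apply: memv_sumr => k _.
  by rewrite -compA -gE memv_img ?memvf.
rewrite (directvP dir) /=; apply: eq_bigr => k _.
by rewrite limg_dim_eq // (eqP (kerg k)) capv0.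
Qed.
End LinearCategory.

(** * Endomorphisms of simple objects over an algebraically closed field *)

Section LinearCategoryClosed.
Import VectorInternalTheory.
Variables (K : numClosedFieldType) (C : linearCategory K).
Hypothesis abC : is_abelian C.
Implicit Types X Y Z W : C.

(** Postcomposition with [f] on [mor X X] has an eigenvector [g]; being nonzero, [g] is invertible,
    and it cancels from [f \oc g = r *: g]. *)
Lemma simple_endo_scalar X (f : mor X X) : is_simple X ->
  exists r : K, f = r *: idm X.
Proof.
move=> sX; have nz := simple_idm_neq0 sX.
have dim_gt0' : (0 < dim (mor X X))%N by rewrite -dimvf (dim_mor_gt0 nz).
pose phi := linfun (@mcomp K C X X X f).
pose psi := v2r \o phi \o r2v.
have [r /eigenvalueP [v vE v0]] := eigenvalue_closed (lin1_mx psi) dim_gt0'.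
exists r; rewrite mul_rV_lin1 /= in vE.
set g := r2v v in vE.
have {}vE : f \oc g = r *: g.
  by apply: (can_inj v2rK); rewrite -[f \oc g](lfunE (mcomp f)) vE linearZ /= r2vK.
have g0 : g != 0 by apply: contra v0 => /eqP g0; rewrite -[v]r2vK -/g g0 linear0.
have [h [_ gh]] := simple_mor_iso abC sX sX g0.
by rewrite -[f]compm1 -gh compA vE compZl.
Qed.

Lemma dim_endo_simple X : is_simple X -> \dim {: mor X X} = 1%N.
Proof.
move=> sX; have nz := simple_idm_neq0 sX.
rewrite -[RHS](_ : \dim <[idm X]> = 1%N); last by rewrite dim_vline nz.
congr (\dim _); apply/vspaceP => f; rewrite memvf.
by have [r ->] := simple_endo_scalar f sX; rewrite memvZ ?memv_line.
Qed.

End LinearCategoryClosed.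

(** * Adjunctions by unit and counit, their composition and mates *)

Section Adjunctions.
Variables (K : fieldType) (C : linearCategory K).

Record endofunctor := Endofunctor {
  fobj :> C -> C;
  fmor : forall X Y, mor X Y -> mor (fobj X) (fobj Y);
  fmor_id : forall X, fmor (idm X) = idm (fobj X);
  fmor_comp : forall X Y Z (g : mor Y Z) (f : mor X Y),
    fmor (g \oc f) = fmor g \oc fmor f
}.

Lemma endofunctor_comp_subproof (F G : endofunctor) :
  (forall X : C, fmor F (fmor G (idm X)) = idm (F (G X))) *
  (forall X Y Z (g : mor Y Z) (f : mor X Y),
     fmor F (fmor G (g \oc f)) = fmor F (fmor G g) \oc fmor F (fmor G f)).
Proof. by split=> *; rewrite ?fmor_id ?fmor_comp. Qed.

Definition endofunctor_comp (F G : endofunctor) : endofunctor :=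
  Endofunctor (endofunctor_comp_subproof F G).1
              (endofunctor_comp_subproof F G).2.

Definition natural (F G : endofunctor) (phi : forall T, mor (F T) (G T)) :=
  forall S T (f : mor S T), phi T \oc fmor F f = fmor G f \oc phi S.

Record adjunction (L R : endofunctor) (eps : forall T, mor (L (R T)) T)
    (eta : forall T, mor T (R (L T))) : Prop := Adjunction {
  eps_natural : forall S T (f : mor S T),
    eps T \oc fmor L (fmor R f) = f \oc eps S;
  eta_natural : forall S T (f : mor S T),
    eta T \oc f = fmor R (fmor L f) \oc eta S;
  adj_zigzagR : forall T, fmor R (eps T) \oc eta (R T) = idm (R T);
  adj_zigzagL : forall T, eps (L T) \oc fmor L (eta T) = idm (L T)
}.

Lemma adjunction_comp (L R L' R' : endofunctor) eps eta eps' eta' :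
  @adjunction L R eps eta -> @adjunction L' R' eps' eta' ->
  @adjunction (endofunctor_comp L' L) (endofunctor_comp R R')
    (fun T => eps' T \oc fmor L' (eps (R' T)))
    (fun T => fmor R (eta' (L T)) \oc eta T).
Proof.
move=> [en hn zR zL] [en' hn' zR' zL']; split=> [S T f|S T f|T|T] /=.
- by rewrite -compA -fmor_comp en fmor_comp compA en' compA.
- by rewrite -compA hn compA -fmor_comp hn' fmor_comp compA.
- rewrite !fmor_comp -!compA [X in _ \oc X]compA -fmor_comp -hn'.
  by rewrite fmor_comp -compA zR compm1 -fmor_comp zR' fmor_id.
- rewrite !fmor_comp -!compA [X in _ \oc X]compA -fmor_comp en.
  rewrite fmor_comp [LHS]compA [X in X \oc _]compA zL' comp1m.
  by rewrite -fmor_comp zL fmor_id.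
Qed.

(** Insert the zigzag of the first adjunction before [psi T], move [psi] by naturality, trade it for
    [phi], and cancel with the zigzag of the second. This turns identities of evaluations into
    identities of coevaluations. *)
Lemma adjunction_mate (L R L' R' : endofunctor) eps eta eps' eta'
    (phi : forall T, mor (R T) (R' T)) (psi : forall T, mor (L' T) (L T)) :
  @adjunction L R eps eta -> @adjunction L' R' eps' eta' ->
  natural psi ->
  (forall T, eps T \oc psi (R T) = eps' T \oc fmor L' (phi T)) ->
  forall T, phi (L T) \oc eta T = fmor R' (psi T) \oc eta' T.
Proof.
move=> [en hn zR zL] [en' hn' zR' zL'] npsi E T.
rewrite -[psi T]comp1m -zL -compA -npsi compA E -compA -fmor_comp fmor_comp.
by rewrite -compA -hn' compA zR' comp1m.
Qed.

End Adjunctions.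

(** * Whiskering, coherence, and the adjunctions given by dual objects *)

Notation "X \lw f" := (idm X \om f) : ring_scope.
Notation "f \rw X" := (f \om idm X) : ring_scope.

(* Locked, lest rewriting with associativity of composition see through them. *)
HB.lock Definition evT (K : fieldType) (C : monoidalCategory K) (V X : C)
    (p : mor (V \ox X) tunit) (T : C) : mor (V \ox (X \ox T)) T :=
  lunit T \oc (p \rw T) \oc assocV V X T.
Arguments evT {K C V X} p T.

HB.lock Definition coevT (K : fieldType) (C : monoidalCategory K) (X V : C)
    (c : mor tunit (X \ox V)) (T : C) : mor T (X \ox (V \ox T)) :=
  assoc X V T \oc (c \rw T) \oc lunitV T.
Arguments coevT {K C X V} c T.

Section Monoidal.
Variables (K : fieldType) (C : monoidalCategory K).
Implicit Types X Y Z T V W : C.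

HB.instance Definition _ X X' Y Y' (f : mor X X') :=
  GRing.isLinear.Build K (mor Y Y') (mor (X \ox Y) (X' \ox Y')) _
    (@tensm K C X X' Y Y' f) (tensm_linearr f).

Definition tensml X X' Y Y' (g : mor Y Y') (f : mor X X') := f \om g.

HB.instance Definition _ X X' Y Y' (g : mor Y Y') :=
  GRing.isLinear.Build K (mor X X') (mor (X \ox Y) (X' \ox Y')) _
    (@tensml X X' Y Y' g) (tensm_linearl g).

Lemma tensm0 X X' Y Y' (f : mor X X') : f \om (0 : mor Y Y') = 0.
Proof. exact: linear0. Qed.

Lemma tensmZr X X' Y Y' k (f : mor X X') (g : mor Y Y') :
  f \om (k *: g) = k *: (f \om g).
Proof. exact: linearZ_LR. Qed.

Lemma tensmZl X X' Y Y' k (f : mor X X') (g : mor Y Y') :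
  (k *: f) \om g = k *: (f \om g).
Proof. exact: (linearZ_LR (@tensml X X' Y Y' g)). Qed.

Lemma tensm_sumr X X' Y Y' (f : mor X X') n (g : 'I_n -> mor Y Y') :
  f \om (\sum_(i < n) g i) = \sum_(i < n) (f \om g i).
Proof. exact: linear_sum. Qed.

Lemma tensm_suml X X' Y Y' n (f : 'I_n -> mor X X') (g : mor Y Y') :
  (\sum_(i < n) f i) \om g = \sum_(i < n) (f i \om g).
Proof. exact: (linear_sum (@tensml X X' Y Y' g)). Qed.

Lemma tens0m X X' Y Y' (g : mor Y Y') : (0 : mor X X') \om g = 0.
Proof. exact: (linear0 (@tensml X X' Y Y' g)). Qed.

Lemma lw_comp X Y Y' Y'' (g : mor Y' Y'') (f : mor Y Y') :
  X \lw (g \oc f) = (X \lw g) \oc (X \lw f).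
Proof. by rewrite -tensm_comp comp1m. Qed.

Lemma rw_comp X Y Y' Y'' (g : mor Y' Y'') (f : mor Y Y') :
  (g \oc f) \rw X = (g \rw X) \oc (f \rw X).
Proof. by rewrite -tensm_comp comp1m. Qed.

Lemma rw_lw X X' Y Y' (f : mor X X') (g : mor Y Y') :
  (f \rw Y') \oc (X \lw g) = f \om g.
Proof. by rewrite -tensm_comp comp1m compm1. Qed.

Lemma lw_rw X X' Y Y' (f : mor X X') (g : mor Y Y') :
  (X' \lw g) \oc (f \rw Y) = f \om g.
Proof. by rewrite -tensm_comp comp1m compm1. Qed.

Lemma interchange X X' Y Y' (f : mor X X') (g : mor Y Y') :
  (f \rw Y') \oc (X \lw g) = (X' \lw g) \oc (f \rw Y).
Proof. by rewrite rw_lw lw_rw. Qed.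

Lemma assocK X Y Z : assocV X Y Z \oc assoc X Y Z = idm _.
Proof. by case: (assoc_iso X Y Z). Qed.
Lemma assocVK X Y Z : assoc X Y Z \oc assocV X Y Z = idm _.
Proof. by case: (assoc_iso X Y Z). Qed.
Lemma lunitK X : lunitV X \oc lunit X = idm _.
Proof. by case: (lunit_iso X). Qed.
Lemma lunitVK X : lunit X \oc lunitV X = idm _.
Proof. by case: (lunit_iso X). Qed.
Lemma runitK X : runitV X \oc runit X = idm _.
Proof. by case: (runit_iso X). Qed.

Lemma assocV_natural X X' Y Y' Z Z' (f : mor X X') (g : mor Y Y') (h : mor Z Z') :
  assocV X' Y' Z' \oc (f \om (g \om h)) = ((f \om g) \om h) \oc assocV X Y Z.
Proof.
rewrite -[LHS]compm1 -(assocVK X Y Z) -compA [X in _ \oc X]compA.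
by rewrite -assoc_natural -!compA (cancel_comp (assocK _ _ _)).
Qed.

Lemma lunitV_natural X Y (f : mor X Y) :
  lunitV Y \oc f = (tunit \lw f) \oc lunitV X.
Proof.
by rewrite -[LHS]compm1 -(lunitVK X) -compA [X in _ \oc X]compA -lunit_natural
           -!compA (cancel_comp (lunitK _)).
Qed.

Lemma lw_tunit_inj X Y (f g : mor X Y) : tunit \lw f = tunit \lw g -> f = g.
Proof.
move=> E; rewrite -[f]compm1 -[g]compm1 -(lunitVK X) !compA -!lunit_natural.
by rewrite E.
Qed.

(* Kelly's consequence of the pentagon and triangle axioms. *)
Lemma lunit_tens X Y : lunit (X \ox Y) \oc assoc tunit X Y = lunit X \rw Y.
Proof.
apply: lw_tunit_inj; rewrite lw_comp.
set b := assoc tunit (tunit \ox X) Y; set c := assoc tunit tunit X \rw Y.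
have bK : b \oc assocV _ _ _ = idm _ by exact: assocVK.
have cK : c \oc (assocV tunit tunit X \rw Y) = idm _.
  by rewrite /c -rw_comp assocVK tensm1.
(* As [b] and [c] are invertible, it is enough to compare after precomposing with them, where the
   pentagon applies. *)
suff E : (tunit \lw lunit (X \ox Y)) \oc (tunit \lw assoc tunit X Y) \oc b \oc c
       = (tunit \lw (lunit X \rw Y)) \oc b \oc c.
  have := congr1 (precomp (assocV _ _ _))
    (congr1 (precomp (assocV tunit tunit X \rw Y)) E).
  by rewrite /precomp -!compA (cancel_comp cK) bK !compm1.
rewrite -!compA [X in _ \oc X]compA -pentagon compA triangle -tensm1 -assoc_natural.
by rewrite /b -(reassoc (assoc_natural _ _ _)) /c -rw_comp triangle.
Qed.

Lemma lunitV_tens X Y : assocV tunit X Y \oc lunitV (X \ox Y) = lunitV X \rw Y.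
Proof.
rewrite -[LHS](cancel_comp (f := lunit X \rw Y) (g := lunitV X \rw Y)).
  by rewrite -lunit_tens -!compA (cancel_comp (assocVK _ _ _)) lunitVK compm1.
by rewrite -rw_comp lunitK tensm1.
Qed.

Lemma triangleV X Y : assocV X tunit Y \oc (X \lw lunitV Y) = runitV X \rw Y.
Proof.
rewrite -[LHS](cancel_comp (f := runit X \rw Y) (g := runitV X \rw Y)).
  rewrite -triangle -!compA (cancel_comp (assocVK _ _ _)) -lw_comp lunitVK.
  by rewrite tensm1 compm1.
by rewrite -rw_comp runitK tensm1.
Qed.

Lemma pentagon_lw W X Y Z :
  (W \lw assocV X Y Z) \oc assoc W X (Y \ox Z) =
  assoc W (X \ox Y) Z \oc (assoc W X Y \rw Z) \oc assocV (W \ox X) Y Z.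
Proof.
rewrite -[LHS]compm1 -(assocVK (W \ox X) Y Z) -!compA.
rewrite (reassoc (pentagon W X Y Z)) -!compA.
by rewrite [LHS]compA -lw_comp assocK tensm1 comp1m.
Qed.

Lemma pentagonV_lw W X Y Z :
  assocV (W \ox X) Y Z \oc assocV W X (Y \ox Z) \oc (W \lw assoc X Y Z) =
  (assocV W X Y \rw Z) \oc assocV W (X \ox Y) Z.
Proof.
rewrite -[RHS](cancel_comp (g := assocV (W \ox X) Y Z \oc assocV W X (Y \ox Z))
  (f := assoc W X (Y \ox Z) \oc assoc (W \ox X) Y Z)).
  rewrite pentagon; congr (_ \oc _); rewrite -!compA.
  by rewrite (reassoc1 (esym (rw_comp _ _ _))) assocVK tensm1 comp1m assocVK compm1.
by rewrite -!compA (cancel_comp (assocK _ _ _)) assocK.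
Qed.

Lemma evTE V X (p : mor (V \ox X) tunit) T :
  evT p T = lunit T \oc (p \rw T) \oc assocV V X T.
Proof. by rewrite evT.unlock. Qed.

Lemma coevTE X V (c : mor tunit (X \ox V)) T :
  coevT c T = assoc X V T \oc (c \rw T) \oc lunitV T.
Proof. by rewrite coevT.unlock. Qed.

Lemma evT_natural V X (p : mor (V \ox X) tunit) S T (f : mor S T) :
  evT p T \oc (V \lw (X \lw f)) = f \oc evT p S.
Proof.
rewrite !evTE -!compA assocV_natural tensm1 (reassoc (interchange _ _)).
by rewrite (reassoc (lunit_natural _)).
Qed.

Lemma coevT_natural X V (c : mor tunit (X \ox V)) S T (f : mor S T) :
  coevT c T \oc f = (X \lw (V \lw f)) \oc coevT c S.
Proof.
rewrite !coevTE -!compA lunitV_natural (reassoc (interchange _ _)) -tensm1.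
by rewrite (reassoc (assoc_natural _ _ _)).
Qed.

Lemma evT_rw V V' X (p : mor (V \ox X) tunit) (h : mor V' V) T :
  evT (p \oc (h \rw X)) T = evT p T \oc (h \rw (X \ox T)).
Proof. by rewrite !evTE rw_comp -!compA -assocV_natural tensm1. Qed.

Lemma evT_lw V X X' (p : mor (V \ox X) tunit) (h : mor X' X) T :
  evT (p \oc (V \lw h)) T = evT p T \oc (V \lw (h \rw T)).
Proof. by rewrite !evTE rw_comp -!compA -assocV_natural. Qed.

Lemma evT_coevT X Y (q : mor (X \ox Y) tunit) (c : mor tunit (X \ox Y)) T :
  evT q T \oc coevT c T = lunit T \oc ((q \oc c) \rw T) \oc lunitV T.
Proof. by rewrite !evTE !coevTE rw_comp -!compA (cancel_comp (assocK _ _ _)). Qed.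

Lemma lw_evT_coevT X V Y (e : mor (V \ox Y) tunit) (c : mor tunit (X \ox V)) T :
  (X \lw evT e T) \oc coevT c (Y \ox T) =
  (runit X \oc (X \lw e) \oc assoc X V Y \oc (c \rw Y) \oc lunitV Y) \rw T.
Proof.
rewrite !evTE !coevTE !lw_comp !rw_comp -!compA.
rewrite (reassoc1 (pentagon_lw _ _ _ _)) -!compA.
rewrite (reassoc (esym (assoc_natural _ _ _))).
rewrite (reassoc1 (triangle _ _)); do 3 congr (_ \oc _).
by rewrite -[idm (Y \ox T)]tensm1 (reassoc (assocV_natural _ _ _)) lunitV_tens.
Qed.

(** The whiskered map on the right is one side of the second duality equation when [Y] is [V], and
    it is [curry p] when [c] is [coev X]; both cases are used. *)
Lemma evT_lw_coevT V X Y (p : mor (V \ox X) tunit) (c : mor tunit (X \ox Y)) T :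
  evT p (Y \ox T) \oc (V \lw coevT c T) =
  (lunit Y \oc (p \rw Y) \oc assocV V X Y \oc (V \lw c) \oc runitV V) \rw T.
Proof.
rewrite !evTE !coevTE !lw_comp !rw_comp -!compA -(triangleV V T).
rewrite -(reassoc (assocV_natural _ _ _)).
rewrite (reassoc (esym (pentagonV_lw _ _ _ _))) -!compA.
rewrite -(reassoc (assocV_natural _ _ _)) tensm1 -lunit_tens -!compA.
by rewrite (cancel_comp (assocVK _ _ _)).
Qed.

Lemma lw_functor_subproof X :
  (forall T, X \lw idm T = idm (X \ox T)) *
  (forall S T U (g : mor T U) (f : mor S T),
     X \lw (g \oc f) = (X \lw g) \oc (X \lw f)).
Proof. by split=> *; rewrite ?tensm1 ?lw_comp. Qed.

Definition lw_functor X : endofunctor C :=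
  Endofunctor (lw_functor_subproof X).1 (lw_functor_subproof X).2.

(** The zigzag identities at [T] are the two duality equations whiskered with [T]. *)
Lemma left_dual_adjunction X V (e : mor (V \ox X) tunit) (c : mor tunit (X \ox V)) :
  is_left_dual e c ->
  @adjunction _ _ (lw_functor V) (lw_functor X) (evT e) (coevT c).
Proof.
case=> z1 z2; split=> [S T f|S T f|T|T] /=.
- exact: evT_natural.
- exact: coevT_natural.
- by rewrite lw_evT_coevT z1 tensm1.
- by rewrite evT_lw_coevT z2 tensm1.
Qed.

Lemma direct_sum_lw X n (S : 'I_n -> C) W : is_direct_sum S W ->
  is_direct_sum (fun k => X \ox S k) (X \ox W).
Proof.
case=> i [p [pi pi0 ip]]; exists (fun k => X \lw i k), (fun k => X \lw p k).
split=> [k|k l kl|]; first by rewrite -lw_comp pi tensm1.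
  by rewrite -lw_comp pi0 // tensm0.
by under eq_bigr do rewrite -lw_comp; rewrite -tensm_sumr ip tensm1.
Qed.

Lemma direct_sum_rw X n (S : 'I_n -> C) W : is_direct_sum S W ->
  is_direct_sum (fun k => S k \ox X) (W \ox X).
Proof.
case=> i [p [pi pi0 ip]]; exists (fun k => i k \rw X), (fun k => p k \rw X).
split=> [k|k l kl|]; first by rewrite -rw_comp pi tensm1.
  by rewrite -rw_comp pi0 // tens0m.
by under eq_bigr do rewrite -rw_comp; rewrite -tensm_suml ip tensm1.
Qed.

End Monoidal.

(** * Evaluation of a tensor product, one factor at a time *)

Section NestedEvaluation.
Variables (K : fieldType) (C : monoidalCategory K).
Implicit Types X Y Z T V W : C.

Lemma evT_rw_assocV V X (q : mor (V \ox X) tunit) Y T :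
  (evT q Y \rw T) \oc assocV V (X \ox Y) T =
  evT q (Y \ox T) \oc (V \lw assoc X Y T).
Proof.
rewrite !evTE !rw_comp -!compA -pentagonV_lw -lunit_tens -!compA.
rewrite -(reassoc (assocV_natural _ _ _)) tensm1.
by rewrite (cancel_comp (assocVK _ _ _)).
Qed.

(** For [q := ev X] and [q' := ev Y] the pairing on the left is the one curried in [dual_tens]. *)
Lemma evT_nested V V' X Y (q : mor (V \ox X) tunit) (q' : mor (V' \ox Y) tunit) T :
  evT (q' \oc (V' \lw (lunit Y \oc (q \rw Y) \oc assocV V X Y))
         \oc assoc V' V (X \ox Y)) T
    \oc assocV V' V ((X \ox Y) \ox T) =
  evT q' T \oc (V' \lw (evT q (Y \ox T) \oc (V \lw assoc X Y T))).
Proof.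
rewrite -evTE -evT_rw_assocV; move: (evT q Y) => e; rewrite lw_comp.
rewrite !evTE !rw_comp -!compA (reassoc (assocV_natural _ _ _)).
do 3 congr (_ \oc _).
have E := pentagon_lw V' V (X \ox Y) T.
rewrite -[in RHS](compm1 (V' \lw _)) -(assocVK V' V _) (reassoc1 E).
by rewrite -!compA (cancel_comp (assocK _ _ _)).
Qed.

End NestedEvaluation.

(** * Dual morphisms and duals of tensor products *)

Section Duality.
Variables (K : fieldType) (C : fusionCategory K).
Implicit Types X Y Z T V W : C.

Let adj X := left_dual_adjunction (dual_left X).

Lemma curry_rw V X (p : mor (V \ox X) tunit) T :
  curry p \rw T = evT p (dual X \ox T) \oc (V \lw coevT (coev X) T).
Proof. by rewrite evT_lw_coevT. Qed.

(** Naturality of [evT p] moves the evaluation of [X] next to its coevaluation, and the zigzag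
    cancels them. *)
Lemma evT_curry V X (p : mor (V \ox X) tunit) T :
  evT (ev X) T \oc (curry p \rw (X \ox T)) = evT p T.
Proof.
rewrite curry_rw compA -evT_natural -compA -lw_comp.
by rewrite (adj_zigzagR (adj X) T) tensm1 compm1.
Qed.

Lemma evT_dualm X Y (f : mor X Y) T :
  evT (ev X) T \oc (dualm f \rw (X \ox T)) =
  evT (ev Y) T \oc (dual Y \lw (f \rw T)).
Proof. by rewrite evT_curry evT_lw. Qed.

(** Whiskering with [f] and with [dualm f] are mates, so [evT_dualm] carries over from counits to
    units. *)
Lemma coevT_dualm X Y (f : mor X Y) T :
  (f \rw (dual X \ox T)) \oc coevT (coev X) T =
  (Y \lw (dualm f \rw T)) \oc coevT (coev Y) T.
Proof.
pose phi T := f \rw T : mor (lw_functor X T) (lw_functor Y T).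
pose psi T := dualm f \rw T : mor (lw_functor (dual Y) T) (lw_functor (dual X) T).
apply: (adjunction_mate (phi := phi) (psi := psi) (adj X) (adj Y)) => [S U g|U].
  exact: interchange.
exact: evT_dualm.
Qed.

Lemma evT_dual_tens X Y T :
  evT (ev (X \ox Y)) T \oc (dual_tens X Y \rw ((X \ox Y) \ox T))
    \oc assocV (dual Y) (dual X) ((X \ox Y) \ox T) =
  evT (ev Y) T \oc (dual Y \lw evT (ev X) (Y \ox T))
    \oc (dual Y \lw (dual X \lw assoc X Y T)).
Proof. by rewrite evT_curry evT_nested lw_comp compA. Qed.

(** The mate of [evT_dual_tens], between the adjunction of [X \ox Y] and the composite of those of
    [X] and [Y]. *)
Lemma coevT_tens X Y T :
  assoc X Y (dual (X \ox Y) \ox T) \oc coevT (coev (X \ox Y)) T =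
  (X \lw (Y \lw ((dual_tens X Y \rw T) \oc assocV (dual Y) (dual X) T)))
    \oc ((X \lw coevT (coev Y) (dual X \ox T)) \oc coevT (coev X) T).
Proof.
pose R := endofunctor_comp (lw_functor X) (lw_functor Y).
pose L := endofunctor_comp (lw_functor (dual Y)) (lw_functor (dual X)).
pose phi T := assoc X Y T : mor (lw_functor (X \ox Y) T) (R T).
pose psi T := (dual_tens X Y \rw T) \oc assocV (dual Y) (dual X) T
  : mor (L T) (lw_functor (dual (X \ox Y)) T).
apply: (adjunction_mate (phi := phi) (psi := psi)
  (adj (X \ox Y)) (adjunction_comp (adj X) (adj Y))) => [S U g|U] /=.
  by rewrite /psi -compA assocV_natural tensm1 !compA interchange.
by rewrite /psi compA evT_dual_tens.
Qed.

(** The map in the conclusion is the adjoint transpose of [f], from which a zigzag recovers [f]. *)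
Lemma mor_to_dual_tens_neq0 X S Z (f : mor S (X \ox Z)) :
  f != 0 -> evT (ev X) Z \oc (dual X \lw f) != 0.
Proof.
apply: contra => /eqP g0.
rewrite -[f]comp1m -(adj_zigzagR (adj X) Z) /= -compA.
rewrite (eta_natural (adj X)) /= compA -lw_comp g0.
by rewrite tensm0 comp0m.
Qed.

(** * The pivotal trace as a loop drawn to the left of an object *)

Section Trace.
Variable a : pivotalStructure C.

Definition trT X (f : mor X X) T : mor T T :=
  evT (ev (dual X)) T \oc ((piv a X \oc f) \rw (dual X \ox T))
    \oc coevT (coev X) T.

(** Slide [g] around the loop: naturality of [piv] replaces it by its double dual, evaluation turns
    that into [dualm g], and coevaluation turns this back into [g]. *)
Lemma trT_cyclic X Y (f : mor X Y) (g : mor Y X) T :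
  trT (g \oc f) T = trT (f \oc g) T.
Proof.
rewrite /trT (reassoc (esym (pivotal_natural a g))) 2!rw_comp -!compA.
rewrite (reassoc (evT_dualm _ _)) -(reassoc (interchange _ _)).
by rewrite -(reassoc (interchange _ _)) -coevT_dualm compA !rw_comp -!compA.
Qed.

Lemma trT_sum X n (f : 'I_n -> mor X X) T :
  trT (\sum_(i < n) f i) T = \sum_(i < n) trT (f i) T.
Proof. by rewrite /trT comp_sumr tensm_suml comp_sumr comp_suml. Qed.

(** The loop of [X \ox Y] becomes two nested loops: both its ends unfold by the formulas for
    [dual_tens], and [pivotal_tens] matches the two in the middle. *)
Lemma trT_tens X Y T :
  trT (idm (X \ox Y)) T =
  evT (ev (dual X)) T \oc (piv a X \om trT (idm Y) (dual X \ox T))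
    \oc coevT (coev X) T.
Proof.
rewrite /trT !compm1.
rewrite -[coevT (coev (X \ox Y)) T](cancel_comp (assocK _ _ _)) coevT_tens.
rewrite !lw_comp -!compA (reassoc (assocV_natural _ _ _)) tensm1.
rewrite (reassoc (interchange _ _)) -(reassoc (evT_dualm _ _)).
rewrite (reassoc1 (esym (rw_comp _ _ _))) pivotal_tens rw_comp -!compA.
rewrite -[idm (_ \ox T)]tensm1 -(reassoc (assocV_natural _ _ _)) tensm1.
have E := evT_dual_tens (dual Y) (dual X) T.
rewrite [LHS]compA [LHS]compA E -!compA !(reassoc1 (esym (tensm_comp _ _ _ _))).
rewrite !comp1m !compm1 -!compA -(reassoc (interchange _ _)).
by rewrite (reassoc1 (esym (lw_comp _ _ _))) assocVK tensm1 comp1m.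
Qed.

End Trace.
End Duality.

(** * Additivity and multiplicativity of the categorical dimension *)

Section CategoricalDimension.
Variables (K : numClosedFieldType) (C : fusionCategory K).
Variable a : pivotalStructure C.
Implicit Types X Y Z T V W : C.

Let abC := fusion_abelian C.
Let unit_simple := fusion_unit_simple C.

Lemma pivotal_trace_scalar X :
  pivotal_trace a X = cat_dim a X *: idm (@tunit K C).
Proof.
rewrite /cat_dim.
have [r ->] := simple_endo_scalar abC (pivotal_trace a X) unit_simple.
rewrite linearZ /=; congr (_ *: _).
have fr : free [tuple idm (@tunit K C)] by rewrite seq1_free simple_idm_neq0.
by have := coord_free ord0 ord0 fr; rewrite /= => ->; rewrite mulr1.
Qed.

Lemma trT_cat_dim X T : trT a (idm X) T = cat_dim a X *: idm T.
Proof.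
rewrite /trT compm1 -evT_rw evT_coevT -/(pivotal_trace a X) pivotal_trace_scalar.
by rewrite tensmZl tensm1 compZr compm1 compZl lunitVK.
Qed.

Lemma scaler_tunit_inj (r s : K) : r *: idm (@tunit K C) = s *: idm tunit -> r = s.
Proof.
move/eqP; rewrite -subr_eq0 -scalerBl scaler_eq0.
by rewrite (negbTE (simple_idm_neq0 unit_simple)) orbF subr_eq0 => /eqP.
Qed.

(** Write the identity of [W] as the sum of the [i k \oc p k]; cyclicity turns each trace into that
    of the identity of [S k]. *)
Lemma cat_dim_direct_sum n (S : 'I_n -> C) W : is_direct_sum S W ->
  cat_dim a W = \sum_(k < n) cat_dim a (S k).
Proof.
case=> i [p [pi _ ip]]; apply: scaler_tunit_inj.
rewrite -trT_cat_dim -ip trT_sum scaler_suml; apply: eq_bigr => k _.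
by rewrite trT_cyclic pi trT_cat_dim.
Qed.

(** The inner of the two nested loops is a scalar, which comes out of the outer one. *)
Lemma cat_dim_tens X Y : cat_dim a (X \ox Y) = cat_dim a X * cat_dim a Y.
Proof.
apply: scaler_tunit_inj; rewrite -trT_cat_dim trT_tens trT_cat_dim tensmZr.
rewrite compZr compZl mulrC -scalerA -trT_cat_dim /trT compm1.
by congr (_ *: _).
Qed.

End CategoricalDimension.

(** * Eigenvalues of nonnegative matrices *)

Section PerronFrobenius.

(** [eigenvalue] refers to row vectors; a matrix and its transpose share the characteristic
    polynomial. *)
Lemma eigenvalue_col (F : fieldType) n (M : 'M[F]_n) (u : 'cV[F]_n) (r : F) :
  M *m u = r *: u -> u != 0 -> eigenvalue M r.
Proof.
move=> Mu u0; have : eigenvalue M^T r.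
  apply/eigenvalueP; exists u^T; first by rewrite -trmx_mul Mu linearZ.
  by rewrite -[0]trmx0 (inj_eq (@trmx_inj _ _ _)).
rewrite !eigenvalue_root_char; have -> // : char_poly M^T = char_poly M.
by rewrite /char_poly -det_tr /char_poly_mx linearB /= tr_scalar_mx map_trmx trmxK.
Qed.

(* Pairing a left eigenvector for [r], taken in absolute value, with the
   positive right eigenvector [u] gives [r <= l]. *)
Lemma positive_eigenvector_max (R : realFieldType) n (M : 'M[R]_n)
    (u : 'I_n -> R) (l r : R) :
  (forall i j, 0 <= M i j) -> (forall i, 0 < u i) ->
  (forall i, \sum_j M i j * u j = l * u i) ->
  0 <= r -> eigenvalue M r ->
  (forall s, 0 <= s -> eigenvalue M s -> s <= r) ->
  r = l.
Proof.
move=> M0 u0 Mu r0 /eigenvalueP [v vM v0] rmax.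
(* This index serves three times: for [0 <= l], for [u] being nonzero, and for the pairing of the
   absolute value of [v] with [u] being positive. *)
have [i0 vi0] : exists i, v 0 i != 0.
  apply/existsP; apply: contraNT v0 => /existsPn v0.
  by apply/eqP/rowP => i; rewrite mxE; apply/eqP/negPn/v0.
have l0 : 0 <= l.
  have : 0 <= l * u i0.
    by rewrite -Mu sumr_ge0 // => j _; rewrite mulr_ge0 // ltW.
  by rewrite pmulr_lge0.
apply/le_anti/andP; split; last first.
  apply: rmax => //; apply: (@eigenvalue_col _ _ _ (\col_i u i)).
    by apply/colP => i; rewrite !mxE -Mu; apply: eq_bigr => j _; rewrite !mxE.
  apply/eqP => /colP /(_ i0); rewrite !mxE => E.
  by have := u0 i0; rewrite E ltxx.
have pos : 0 < \sum_j `|v 0 j| * u j.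
  rewrite (bigD1 i0) //= ltr_wpDr ?mulr_gt0 ?normr_gt0 //.
  by apply: sumr_ge0 => j _; rewrite mulr_ge0 // ltW.
rewrite -(ler_pM2r pos) !mulr_sumr.
have -> : \sum_i l * (`|v 0 i| * u i) = \sum_j (\sum_i `|v 0 i| * M i j) * u j.
  under [RHS]eq_bigr do rewrite mulr_suml.
  rewrite exchange_big /=; apply: eq_bigr => i _.
  rewrite mulrCA -Mu mulr_sumr; apply: eq_bigr => j _; by rewrite mulrA.
apply: ler_sum => j _; rewrite mulrA; apply: ler_wpM2r; first exact: ltW.
rewrite -{1}(ger0_norm r0) -normrM.
have -> : r * v 0 j = \sum_i v 0 i * M i j.
  by have /rowP /(_ j) := vM; rewrite !mxE => <-.
apply: le_trans (ler_norm_sum _ _ _) _; apply: ler_sum => i _.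
by rewrite normrM (ger0_norm (M0 i j)).
Qed.

(** The larger root [l] of [(x - a) * (x - e) = b * c] is at least [a] and [e]. Hence [(b, l - a)]
    serves if [b] is positive and [(l - e, c)] if [c] is; otherwise the matrix is diagonal and a
    coordinate vector serves. *)
Lemma perron_vector2 (R : rcfType) (a b c e : R) :
  0 <= a -> 0 <= b -> 0 <= c -> 0 <= e ->
  exists l g1 g2 : R, [/\ 0 <= g1, 0 <= g2, 0 < g1 + g2,
    a * g1 + b * g2 = l * g1 & c * g1 + e * g2 = l * g2].
Proof.
move=> a0 b0 c0 e0.
pose s := Num.sqrt ((a - e) ^+ 2 + 4 * (b * c)).
have s0 : 0 <= s by exact: sqrtr_ge0.
have bc0 : 0 <= b * c by exact: mulr_ge0.
have s2 : s ^+ 2 = (a - e) ^+ 2 + 4 * (b * c).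
  by rewrite sqr_sqrtr // addr_ge0 ?sqr_ge0 // mulr_ge0.
have sa : a - e <= s.
  have [|?] := lerP (a - e) 0; first by move/le_trans; apply.
  rewrite -(ler_pXn2r (n := 2)) ?nnegrE //; [nra | lra].
have se : e - a <= s.
  have [|?] := lerP (e - a) 0; first by move/le_trans; apply.
  rewrite -(ler_pXn2r (n := 2)) ?nnegrE //; [nra | lra].
have lE : ((a + e + s) / 2 - a) * ((a + e + s) / 2 - e) = b * c.
  have -> : b * c = (s ^+ 2 - (a - e) ^+ 2) / 4 by rewrite s2; field.
  by field.
exists ((a + e + s) / 2); set l := (a + e + s) / 2 in lE *.
have la : 0 <= l - a by rewrite /l; lra.
have le : 0 <= l - e by rewrite /l; lra.
have [b_gt0|b_le0] := ltrP 0 b.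
  by exists b, (l - a); split; [| |lra|ring|rewrite [c * b]mulrC -lE; ring].
have [c_gt0|c_le0] := ltrP 0 c.
  by exists (l - e), c; split; [| |lra|rewrite -lE; ring|ring].
have bE : b = 0 by apply/le_anti/andP.
have cE : c = 0 by apply/le_anti/andP.
move/eqP: lE; rewrite bE mul0r mulf_eq0 !subr_eq0 => /orP [] /eqP ->.
  by exists 1, 0; split; rewrite ?cE //; [lra|ring|ring].
by exists 0, 1; split; rewrite ?cE //; [lra|ring|ring].
Qed.

(** Multiplying the eigenvector equations by the adjugate shows that the determinant annihilates
    both coordinates. *)
Lemma eigenvalue2_char (F : idomainType) (a b c e x g1 g2 : F) :
  (g1 != 0) || (g2 != 0) ->
  a * g1 + b * g2 = x * g1 -> c * g1 + e * g2 = x * g2 ->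
  (x - a) * (x - e) = b * c.
Proof.
move=> g0 E1 E2; apply/eqP; rewrite -subr_eq0.
have F1 : ((x - a) * (x - e) - b * c) * g1 = 0.
  transitivity ((x - e) * (x * g1 - (a * g1 + b * g2))
                + b * (x * g2 - (c * g1 + e * g2))); first by ring.
  by rewrite E1 E2; ring.
have F2 : ((x - a) * (x - e) - b * c) * g2 = 0.
  transitivity ((x - a) * (x * g2 - (c * g1 + e * g2))
                + c * (x * g1 - (a * g1 + b * g2))); first by ring.
  by rewrite E1 E2; ring.
by case/orP: g0 => /mulIf inj; apply/eqP/inj; rewrite mul0r.
Qed.

End PerronFrobenius.

(** * Additive functions on objects and multiplicities of simple constituents *)

Definition additive_on_objects (K : fieldType) (C : linearCategory K)
    (G : zmodType) (phi : C -> G) : Prop :=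
  forall n (S : 'I_n -> C) W, is_direct_sum S W -> phi W = \sum_(k < n) phi (S k).

Lemma additive_isomorphic (K : fieldType) (C : linearCategory K)
    (G : zmodType) (phi : C -> G) X Y :
  additive_on_objects phi -> isomorphic X Y -> phi Y = phi X.
Proof. by move=> add_phi /direct_sum_isomorphic /add_phi ->; rewrite big_ord1. Qed.

Section Multiplicities.
Variables (K : numClosedFieldType) (C : fusionCategory K).
Implicit Types X Y Z T V W : C.

Let abC := fusion_abelian C.
Let ssC : is_semisimple C := @fusion_semisimple K C.

Lemma dim_mor_simple X Y : is_simple X -> is_simple Y -> isomorphic X Y ->
  \dim {: mor X Y} = 1%N.
Proof.
move=> sX sY /direct_sum_isomorphic /(dim_mor_direct_sum X) ->.
by rewrite big_ord1 dim_endo_simple.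
Qed.

(** Let [kap] send each simple summand of [W] to its representative. By Schur's lemma
    [mor (U i) (S j)] has dimension one if [kap j = i] and zero otherwise, so [mor (U i) W] counts
    the fibre of [kap] over [i]. *)
Lemma additive_multiplicities (G : zmodType) (phi : C -> G)
    (I : finType) (U : I -> C) W :
  additive_on_objects phi ->
  (forall i, is_simple (U i)) ->
  (forall i j, isomorphic (U i) (U j) -> i = j) ->
  (forall T (s : mor T W) (r : mor W T), is_simple T -> r \oc s = idm T ->
     exists i, isomorphic T (U i)) ->
  phi W = \sum_i phi (U i) *+ \dim {: mor (U i) W}.
Proof.
move=> add_phi sU injU covU; have [n [S [sS dW]]] := ssC W.
have [kap kapP] : exists kap : 'I_n -> I, forall j, isomorphic (S j) (U (kap j)).
  apply: (fin_all_exists (P := fun j i => isomorphic (S j) (U i))) => j.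
  by case: dW => s [r [rs _ _]]; exact: (covU _ (s j) (r j)).
have dimE i j : \dim {: mor (U i) (S j)} = (kap j == i) :> nat.
  have [<-|nij] := eqVneq.
    by rewrite dim_mor_simple //; exact: isomorphic_sym.
  rewrite (dim_mor_simple_noniso abC) // => iso; case/eqP: nij.
  exact/esym/injU/(isomorphic_trans iso).
rewrite (add_phi _ _ _ dW).
under [RHS]eq_bigr => i _ do rewrite (dim_mor_direct_sum _ dW) -sumrMnr.
rewrite exchange_big /=; apply: eq_bigr => j _.
rewrite (bigD1 (kap j)) //= dimE eqxx mulr1n big1 ?addr0.
  exact: (additive_isomorphic add_phi (isomorphic_sym (kapP j))).
by move=> i; rewrite dimE eq_sym => /negbTE ->; rewrite mulr0n.
Qed.

Lemma additive_dim_mor (G : nzRingType) Z :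
  additive_on_objects (fun W : C => (\dim {: mor Z W})%:R : G).
Proof. by move=> n S W /(dim_mor_direct_sum Z) ->; rewrite natr_sum. Qed.

Lemma additive_dim_mor_lw (G : nzRingType) X Z :
  additive_on_objects (fun W : C => (fusion_coef X W Z)%:R : G).
Proof. by move=> n S W /(direct_sum_lw X) /(@additive_dim_mor G Z). Qed.

Lemma additive_dim_mor_rw (G : nzRingType) X Z :
  additive_on_objects (fun W : C => (fusion_coef W X Z)%:R : G).
Proof. by move=> n S W /(direct_sum_rw X) /(@additive_dim_mor G Z). Qed.

Lemma fusion_coefA X Y V Z :
  fusion_coef (X \ox Y) V Z = fusion_coef X (Y \ox V) Z.
Proof.
have iso : isomorphic ((X \ox Y) \ox V) (X \ox (Y \ox V)).
  by exists (assoc X Y V), (assocV X Y V); exact: assoc_iso.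
rewrite /fusion_coef.
by rewrite (dim_mor_direct_sum Z (direct_sum_isomorphic iso)) big_ord1.
Qed.

Section Subcategory.
Variables (D : C -> Prop) (hD : is_fusion_subcategory D).

(** A nonzero map from [Y] to [X \ox Z] transposes to a nonzero map from [dual X \ox Y] to [Z],
    which splits and would put [Z] in [D]. *)
Lemma fusion_coef_sub0 X Y Z :
  D X -> D Y -> is_simple Z -> ~ D Z -> fusion_coef X Z Y = 0%N.
Proof.
move=> DX DY sZ nDZ; apply/eqP/negPn/negP => /dim_mor_neq0 [f f0].
have g0 := mor_to_dual_tens_neq0 f0.
have [s gs] := simple_epi_split abC ssC sZ g0.
apply: nDZ; apply: (fsub_summand hD gs).
by apply: (fsub_tens hD) => //; exact: (fsub_dual hD).
Qed.

Lemma coev_neq0 X : is_simple X -> coev X != 0.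
Proof.
move=> sX; apply: contra (simple_idm_neq0 sX) => /eqP c0.
by case: (dual_left X) => <- _; rewrite c0 tens0m compm0 comp0m.
Qed.

(** Since [coev X] splits, [Z] maps nontrivially to [X \ox (dual X \ox Z)], hence to [X \ox T] for a
    simple summand [T] of [dual X \ox Z]. If [T] were in [D], so would be [Z], a summand of
    [X \ox T]. *)
Lemma fusion_coef_outside_neq0 X Z :
  is_simple X -> D X -> is_simple Z -> ~ D Z ->
  exists T, [/\ is_simple T, ~ D T & fusion_coef X T Z != 0%N].
Proof.
move=> sX DX sZ nDZ.
have [r rc] := simple_mono_split abC ssC (fusion_unit_simple C) (coev_neq0 sX).
pose f : mor Z (X \ox (dual X \ox Z)) := coevT (coev X) Z.
have f0 : f != 0.
  apply: contra (simple_idm_neq0 sZ) => /eqP f0.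
  have := evT_coevT r (coev X) Z.
  by rewrite -/f f0 compm0 rc tensm1 compm1 lunitVK => <-.
have [n [S [sS dW]]] := ssC (dual X \ox Z).
have dX := direct_sum_lw X dW; case: dX => s [p [_ _ sp]].
have [j pf0] : exists j, p j \oc f != 0.
  apply/existsP; apply: contraNT f0 => /existsPn pf0.
  rewrite -[f]comp1m -sp comp_suml big1 // => k _.
  by rewrite -compA (eqP (negPn (pf0 k))) compm0.
exists (S j); split=> //; last by rewrite -lt0n; apply: dim_mor_gt0 pf0.
move=> DS; have [q qf] := simple_mono_split abC ssC sZ pf0.
by apply: nDZ; apply: (fsub_summand hD qf); apply: (fsub_tens hD).
Qed.

Lemma isomorphic_sub X Y : isomorphic X Y -> D X -> D Y.
Proof. by case=> f [g [_ fg]]; apply: (fsub_summand hD fg). Qed.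

Lemma additive_sub (G : zmodType) (phi : C -> G) n (S : 'I_n -> C) W :
  simple_transversal D S -> additive_on_objects phi -> D W ->
  phi W = \sum_(k < n) phi (S k) *+ \dim {: mor (S k) W}.
Proof.
case=> sS injS covS add_phi DW.
apply: additive_multiplicities injS _ => // [i|T s r sT rs]; first by case: (sS i).
by apply: covS => //; apply: (fsub_summand hD rs).
Qed.

End Subcategory.
End Multiplicities.

(** * Categorical dimensions are algebraic integers *)

Section Integrality.
Variables (K : numClosedFieldType) (C : fusionCategory K) (a : pivotalStructure C).

Lemma cat_dim_integral (X : C) : integralOver (intr : int -> K) (cat_dim a X).
Proof.
have [n [S [sS injS covS]]] := fusion_finite C.
have decomp W : cat_dim a W = \sum_(i < n) cat_dim a (S i) *+ \dim {: mor (S i) W}.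
  apply: additive_multiplicities injS _ => [||T _ _ sT _].
  - exact: cat_dim_direct_sum.
  - by move=> i; case: (sS i).
  - exact: covS.
pose M : 'M[int]_n := \matrix_(i, j) (fusion_coef X (S i) (S j))%:Z.
pose u : 'cV[K]_n := \col_i cat_dim a (S i).
(* If all simple dimensions vanish, so does that of [X]; otherwise [u] is an eigenvector of the
   integer matrix [M] for [cat_dim a X]. *)
have [u0|u0] := eqVneq u 0.
  rewrite decomp big1; first exact: (integral0 (intr : {rmorphism int -> K})).
  by move=> i _; have /colP /(_ i) := u0; rewrite !mxE => ->; rewrite mul0rn.
exists (char_poly M); first exact: char_poly_monic.
rewrite (map_char_poly (intr : {rmorphism int -> K})) -eigenvalue_root_char.
apply: eigenvalue_col u0; apply/colP => i; rewrite !mxE -cat_dim_tens decomp.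
by apply: eq_bigr => j _; rewrite !mxE /= -pmulrn mulr_natl.
Qed.

End Integrality.

Lemma quadratic_integer_equation (K : numFieldType) (x : K) (u v : rat) :
  integralOver (intr : int -> K) x -> x ^+ 2 = ratr u * x + ratr v ->
  quadratic_integer x.
Proof.
move=> ix xE; split=> //; pose q : {poly rat} := u%:P * 'X + v%:P.
have size_q : (size (- q) < size ('X^2 : {poly rat}))%N.
  rewrite size_polyN size_polyXn size_MXaddC; case: ifP => // _.
  by rewrite ltnS size_polyC; case: eqP.
exists ('X^2 - q); split.
- by rewrite -size_poly_gt0 size_polyDl // size_polyXn.
- by rewrite size_polyDl // size_polyXn.
- rewrite /root rmorphB /= map_polyXn rmorphD rmorphM /= !map_polyC map_polyX /=.
  by rewrite !hornerE xE subrr.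
Qed.

(** * The action of the subcategory on the two remaining simple objects *)

Section TwoSimplesOutside.
Variables (K : numClosedFieldType) (C : fusionCategory K) (a : pivotalStructure C).
Variables (D : C -> Prop) (hD : is_fusion_subcategory D).
Variables (n : nat) (S : 'I_n -> C) (trS : simple_transversal D S).
Variable rho : bool -> C.
Hypothesis rho_simple : forall b, is_simple (rho b).
Hypothesis rho_outside : forall b, ~ D (rho b).
Hypothesis rho_inj : forall b c, isomorphic (rho b) (rho c) -> b = c.
Hypothesis rho_cover :
  forall Z, is_simple Z -> ~ D Z -> exists b, isomorphic Z (rho b).
Implicit Types X Y Z W : C.

(** [S] and [rho] together represent all simple objects once each; closure of [D] under isomorphism
    keeps the two families apart. *)
Lemma additive_all (G : zmodType) (phi : C -> G) W :
  additive_on_objects phi ->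
  phi W = \sum_(k < n) phi (S k) *+ \dim {: mor (S k) W}
          + \sum_b phi (rho b) *+ \dim {: mor (rho b) W}.
Proof.
case: trS => sS injS covS add_phi.
pose U (i : 'I_n + bool) := match i with inl k => S k | inr b => rho b end.
rewrite (@additive_multiplicities _ _ _ phi _ U) //.
- by rewrite big_sumType.
- by case=> [k|b] //=; case: (sS k).
- case=> [k|b] [l|c] /= iso.
  + by rewrite (injS _ _ iso).
  + by case: (@rho_outside c); apply: (isomorphic_sub hD) iso _; case: (sS k).
  + case: (@rho_outside b); apply: (isomorphic_sub hD) (isomorphic_sym iso) _.
    by case: (sS l).
  + by rewrite (rho_inj iso).
- move=> T s r sT _; have [DT|nDT] := EM (D T).
    by have [k iso] := covS _ sT DT; exists (inl k).
  by have [b iso] := rho_cover sT nDT; exists (inr b).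
Qed.

Lemma additive_sub_rho (G : zmodType) (phi : C -> G) X b :
  additive_on_objects phi -> D X ->
  phi (X \ox rho b) = \sum_c phi (rho c) *+ fusion_coef X (rho b) (rho c).
Proof.
move=> add_phi DX; rewrite (additive_all _ add_phi) big1 ?add0r // => k _.
case: trS => sS _ _; rewrite -/(fusion_coef _ _ _).
by rewrite (fusion_coef_sub0 hD) //; case: (sS k).
Qed.

Lemma cat_dim_sub_rho X b : D X ->
  \sum_c (fusion_coef X (rho b) (rho c))%:R * cat_dim a (rho c)
  = cat_dim a X * cat_dim a (rho b).
Proof.
move=> DX; rewrite -cat_dim_tens.
rewrite (additive_sub_rho b (@cat_dim_direct_sum _ _ a) DX).
by apply: eq_bigr => c _; rewrite mulr_natl.
Qed.

(** No column of the action of [X] vanishes; this makes the eigenvector in [cat_dim_sub_int]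
    strictly positive. *)
Lemma rho_hit X c : is_simple X -> D X ->
  (0 < \sum_b fusion_coef X (rho b) (rho c))%N.
Proof.
move=> sX DX.
have [T [sT nDT NT]] :=
  fusion_coef_outside_neq0 hD sX DX (@rho_simple c) (@rho_outside c).
have [b iso] := rho_cover sT nDT; rewrite (bigD1 b) //= addn_gt0.
have /eqP := additive_isomorphic (@additive_dim_mor_lw _ C int X (rho c)) iso.
by rewrite eqr_nat => /eqP ->; rewrite lt0n NT.
Qed.

Section Integral.
Variables (R : realType) (hDint : is_integral R D).

(* The dimension of [X] and its Frobenius-Perron dimension are eigenvalues of
   the same 2x2 integer matrix, the action of [X] on [rho true] and [rho false];
   the second one is an integer, hence so is the first. *)
Lemma cat_dim_sub_int X :
  (cat_dim a (rho true) != 0) || (cat_dim a (rho false) != 0) ->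
  is_simple X -> D X -> exists m : int, cat_dim a X = m%:~R.
Proof.
move=> dim_rho_neq0 sX DX; have [m [n' [S' [trS' m0 eigm maxm]]]] := hDint DX.
pose A b c := fusion_coef X (rho b) (rho c).
have [l [g1 [g2 [g10 g20 g12 E1 E2]]]] := perron_vector2
  (ler0n R (A true true)) (ler0n R (A true false))
  (ler0n R (A false true)) (ler0n R (A false false)).
pose g b := if b then g1 else g2.
have g_ge0 b : 0 <= g b by case: b.
have gE b : \sum_c (A b c)%:R * g c = l * g b by rewrite big_bool; case: b.
(* Apply the action matrix of [S' i] to the Perron vector [g] of [X] and add up the entries. As the
   action respects tensor products, [u] is an eigenvector of multiplication by [X] on the
   Grothendieck ring of [D], again for [l]. *)
pose u i := \sum_b \sum_c (fusion_coef (S' i) (rho b) (rho c))%:R * g c.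
(* Every column sum of the action of [S' i] is at least one, so [u i] is at least [g1 + g2]. *)
have u_gt0 i : 0 < u i.
  apply: lt_le_trans g12 _; rewrite /u exchange_big /=.
  have -> : g1 + g2 = \sum_c g c by rewrite big_bool.
  apply: ler_sum => c _; rewrite -mulr_suml ler_peMl // -natr_sum ler1n.
  by case: trS' => sS' _ _; case: (sS' i) => sS'i DS'i; exact: rho_hit.
have uE i : \sum_j (fusion_coef X (S' i) (S' j))%:R * u j = l * u i.
  have DS'i : D (S' i) by case: trS' => /(_ i) [].
  (* Both sides are the multiplicity of [rho c] in [X \ox S' i \ox rho b], bracketed in the two
     ways. *)
  have coefE b c : \sum_j (fusion_coef X (S' i) (S' j))%:R *
        (fusion_coef (S' j) (rho b) (rho c))%:R
      = \sum_d (fusion_coef (S' i) (rho b) (rho d))%:R * (A d c)%:R :> R.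
    have := additive_sub hD trS' (@additive_dim_mor_rw _ C R (rho b) (rho c))
      (fsub_tens hD DX DS'i).
    rewrite fusion_coefA.
    rewrite (additive_sub_rho b (@additive_dim_mor_lw _ C R X (rho c)) DS'i) => E.
    under eq_bigr do rewrite mulr_natl.
    by rewrite -E; apply: eq_bigr => d _; rewrite mulr_natl.
  rewrite /u; under eq_bigr do rewrite mulr_sumr.
  rewrite exchange_big mulr_sumr /=; apply: eq_bigr => b _.
  under eq_bigr do rewrite mulr_sumr.
  rewrite exchange_big /=.
  under eq_bigr => c _ do under eq_bigr => j _ do rewrite mulrA.
  under eq_bigr => c _ do rewrite -mulr_suml coefE mulr_suml.
  rewrite exchange_big mulr_sumr /=; apply: eq_bigr => d _.
  rewrite mulrCA -gE mulr_sumr; apply: eq_bigr => c _; by rewrite mulrA.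
have lE : m%:~R = l.
  apply: positive_eigenvector_max u_gt0 _ m0 eigm maxm => [i j|i].
    by rewrite mxE ler0n.
  by rewrite -uE; apply: eq_bigr => j _; rewrite mxE.
have g_neq0 : (g1 != 0) || (g2 != 0).
  rewrite -negb_and; apply/negP => /andP [/eqP g1E /eqP g2E].
  by move: g12; rewrite g1E g2E addr0 ltxx.
(* The characteristic equation of [l] is pulled back to the integers, so that it can be read in
   [K]. *)
have mE : (m - (A true true)%:Z) * (m - (A false false)%:Z)
        = (A true false)%:Z * (A false true)%:Z.
  apply: (intr_inj (R := R)); rewrite !(rmorphM, rmorphB) /= -!pmulrn.
  by rewrite lE; exact: eigenvalue2_char g_neq0 E1 E2.
have := cat_dim_sub_rho true DX; have := cat_dim_sub_rho false DX.
rewrite !big_bool /= => F2 F1; have xE := eigenvalue2_char dim_rho_neq0 F1 F2.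
(* One root of the monic quadratic is [m], so the other is the trace minus [m], also an integer. *)
have : (cat_dim a X - m%:~R) *
       (cat_dim a X - ((A true true)%:Z + (A false false)%:Z - m)%:~R) = 0.
  move/(congr1 (intr : int -> K)): mE.
  rewrite !(rmorphM, rmorphB, rmorphD) /= -!pmulrn.
  rewrite -xE /A; set x := cat_dim a X; set t := _%:R; set t' := _%:R => mE.
  transitivity ((x - t) * (x - t') - (m%:~R - t) * (m%:~R - t')); first by ring.
  by rewrite mE subrr.
move/eqP; rewrite mulf_eq0 !subr_eq0 => /orP [] /eqP ->; first by exists m.
by eexists.
Qed.

Lemma quadratic_integer_rho X b :
  is_simple X -> D X -> fusion_coef X (rho b) (rho (~~ b)) != 0%N ->
  quadratic_integer (cat_dim a (rho b)) /\
  quadratic_integer (cat_dim a (rho (~~ b))).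
Proof.
move=> sX DX NX.
(* If both dimensions vanish, they satisfy [x ^+ 2 = 0]. *)
have [d0|] := boolP ((cat_dim a (rho true) != 0) || (cat_dim a (rho false) != 0));
  last first.
  rewrite negb_or !negbK => /andP [d1 d2].
  have d0 c : cat_dim a (rho c) = 0 by case: c; apply/eqP.
  by split; apply: (quadratic_integer_equation (u := 0) (v := 0));
    [exact: cat_dim_integral|rewrite d0 rmorph0 expr0n mulr0 addr0
    |exact: cat_dim_integral|rewrite d0 rmorph0 expr0n mulr0 addr0].
have sum_bool (F : bool -> K) : \sum_c F c = F b + F (~~ b).
  by rewrite big_bool; case: (b) => //; rewrite addrC.
have [m mE] := cat_dim_sub_int d0 sX DX.
(* Row [b] of the eigenvector equation is solved for the other dimension; its off-diagonal
   coefficient is nonzero by [NX]. *)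
have [q dq] : exists q : rat, cat_dim a (rho (~~ b)) = ratr q * cat_dim a (rho b).
  exists ((m%:~R - (fusion_coef X (rho b) (rho b))%:R)
          / (fusion_coef X (rho b) (rho (~~ b)))%:R).
  have N0 : (fusion_coef X (rho b) (rho (~~ b)))%:R != 0 :> K by rewrite pnatr_eq0.
  rewrite fmorph_div rmorphB /= !ratr_nat ratr_int -mE.
  apply: (mulfI N0); rewrite mulrA (mulrC _ (_ / _)) divfK // mulrBl.
  by rewrite -cat_dim_sub_rho // sum_bool addrAC subrr add0r.
have [t tE] : exists t : 'I_n -> int, forall k, cat_dim a (S k) = (t k)%:~R.
  apply: (fin_all_exists (P := fun k z => cat_dim a (S k) = z%:~R)) => k.
  by case: trS => sS _ _; case: (sS k) => sSk DSk; exact: cat_dim_sub_int.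
set d := cat_dim a (rho b) in dq *.
pose N c := fusion_coef (rho b) (rho b) (rho c).
pose u : rat := (N b)%:R + (N (~~ b))%:R * q.
pose v : rat := \sum_k (t k)%:~R *+ fusion_coef (rho b) (rho b) (S k).
(* Decompose [rho b \ox rho b]: the constituents in [D] contribute the rational constant [v], the
   other two a rational multiple of [d]. *)
have dE : d ^+ 2 = ratr u * d + ratr v.
  rewrite expr2 -cat_dim_tens (additive_all _ (@cat_dim_direct_sum _ _ a)).
  rewrite addrC sum_bool dq /u /v rmorphD rmorphM rmorph_sum /= !ratr_nat.
  congr (_ + _).
    by rewrite mulrDl -(mulrA _ (ratr q) d) !mulr_natl.
  by apply: eq_bigr => k _; rewrite rmorphMn /= ratr_int tE.
split; first exact: (quadratic_integer_equation (cat_dim_integral a _) dE).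
(* This is the equation of [d] multiplied by the square of [q]. *)
apply: (quadratic_integer_equation (u := q * u) (v := q * (q * v))).
  exact: cat_dim_integral.
rewrite dq exprMn dE !rmorphM /=.
by move: (ratr q) (ratr u) (ratr v) => q' u' v'; ring.
Qed.

End Integral.
End TwoSimplesOutside.

(** * Counting simple objects, and the conclusion *)

Lemma rank_two_outside (K : fieldType) (C : fusionCategory K) (D : C -> Prop)
    (rankC rankD : nat) (rho1 rho2 : C) :
  has_rank (fun _ : C => True) rankC -> has_rank D rankD ->
  (rankD + 2 = rankC)%N ->
  (forall Z : C, is_simple Z -> ~ D Z -> isomorphic Z rho1 \/ isomorphic Z rho2) ->
  ~ isomorphic rho1 rho2.
Proof.
move=> [T [sT injT _]] [S [sS _ covS]] hrank cov iso.
(* If [rho1] and [rho2] were isomorphic, [None] would stand for their common class, and the simple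
   classes of [C] would inject into a set of [rankD + 1] elements. *)
have [kap kapP] : exists kap : 'I_rankC -> option 'I_rankD,
    forall k, isomorphic (T k) (if kap k is Some j then S j else rho1).
  apply: (fin_all_exists (P := fun k i =>
    isomorphic (T k) (if i is Some j then S j else rho1))) => k.
  have [sTk _] := sT k; have [DT|nDT] := EM (D (T k)).
    by have [j ?] := covS _ sTk DT; exists (Some j).
  exists None; have [//|] := cov _ sTk nDT.
  by move/isomorphic_trans; apply; exact: isomorphic_sym.
have kap_inj : injective kap.
  move=> k l E; apply: injT; apply: isomorphic_trans (kapP k) _.
  by rewrite E; exact: isomorphic_sym.
have := leq_card _ kap_inj.
by rewrite card_option !card_ord -hrank addn2 ltnn.
Qed.

Theorem lemma5p2 (R : realType) (C : fusionCategory R[i])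
    (a : sphericalStructure C) (D : C -> Prop) (rankC rankD : nat)
    (rho1 rho2 : C)
    (hD : is_fusion_subcategory D)
    (hDint : is_integral R D)
    (hrankC : has_rank (fun _ : C => True) rankC)
    (hrankD : has_rank D rankD)
    (hrank : (rankD + 2 = rankC)%N)
    (hrho : forall Z : C, (is_simple Z /\ ~ D Z) <->
                          (isomorphic Z rho1 \/ isomorphic Z rho2))
    (hX : exists X : C, [/\ is_simple X, D X &
            fusion_coef X rho1 rho2 <> 0%N \/ fusion_coef X rho2 rho1 <> 0%N]) :
  quadratic_integer (cat_dim a rho1) /\ quadratic_integer (cat_dim a rho2).
Proof.
have hcov Z (sZ : is_simple Z) (nDZ : ~ D Z) := (hrho Z).1 (conj sZ nDZ).
have niso := rank_two_outside hrankC hrankD hrank hcov.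
have [S trS] := hrankD.
(* Indexing by booleans makes negation exchange the two objects, so one argument treats both
   alternatives. *)
pose rho (b : bool) := if b then rho1 else rho2.
have rhoP b : is_simple (rho b) /\ ~ D (rho b).
  by apply/hrho; case: b; [left|right]; exact: isomorphic_refl.
have rho_inj b c : isomorphic (rho b) (rho c) -> b = c.
  by case: b; case: c => // /isomorphic_sym // /isomorphic_sym.
have rho_cover Z : is_simple Z -> ~ D Z -> exists b, isomorphic Z (rho b).
  by move=> sZ nDZ; case: (hcov Z sZ nDZ); [exists true|exists false].
have [X [sX DX NX]] := hX.
have main := @quadratic_integer_rho _ C a D hD _ S trS rho (fun b => (rhoP b).1)
  (fun b => (rhoP b).2) rho_inj rho_cover R hDint X _ sX DX.
(* The second alternative is the case [b = false], whose two conclusions come in reverse order. *)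
case: NX => /eqP NX; first exact: (main true).
by have [] := main false NX.
Qed.
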